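(* Let $H$ be an inner product space over $\mathbb{F}$, let $G\subset H$ be an isometry-invariant open set with $0\notin G$, let $R=\{\|g\|:g\in G\}$, and let $\rho$ be a Finsler metric on $G$. Then $\rho$ is isometry-invariant if and only if there is a (unique) function $\lambda:R\times\mathbb{R}^2\to\mathbb{R}$, $(r,(p,q))\mapsto\lambda_r(p,q)$, such that: (1) $\lambda_r(tp,tq)=t\lambda_r(p,q)$ and $\lambda_r(-p,q)=\lambda_r(p,-q)=\lambda_r(p,q)$ for all $r\in R$, $p,q\in\mathbb{R}$, $t\ge 0$; (2) $\rho_g(h)=\lambda_{\|g\|}\left(|\langle h,g\rangle|,\sqrt{\|h\|^2\|g\|^2-|\langle h,g\rangle|^2}\right)$ for every $g\in G$, $h\in H$.
   Context: $\mathbb{F}$ is $\mathbb{R}$ or $\mathbb{C}$; $H$ may be finite- or infinite-dimensional. An isometry is an $\mathbb{F}$-linear map $H\to H$ preserving the inner product (not necessarily surjective). A set $G\subset H$ is isometry-invariant if $TG\subset G$ for every isometry $T$; an isometry-invariant open set has the form $G=\bigcup_{r\in R}rS$ with $S$ the unit sphere of $H$ and $R$ an open set in $[0,+\infty)$. A Finsler metric on $G$ is a function $\rho:G\times H\to\mathbb{R}$, $(g,h)\mapsto\rho_g(h)$, with $\rho_g(rh)=|r|\rho_g(h)$ for all $g\in G$, $h\in H$, $r\in\mathbb{F}$ (nothing else is assumed). $\rho$ is isometry-invariant if $\rho_{Tg}(Th)=\rho_g(h)$ for all isometries $T$ and all $g\in G$, $h\in H$.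
   Formalization: The uniqueness of λ is asserted only when H is not one-dimensional: in dimension one the second argument of λ in (2) is always 0, so λ and λ+|q| both satisfy (1) and (2); the equivalence with existence of λ is kept in every dimension. *)

(* Defs.v *)
From HB Require Import structures.
From mathcomp Require Import all_boot all_order all_algebra.
From mathcomp Require Import complex.
From mathcomp Require Import boolp classical_sets functions reals topology.
From mathcomp Require Import normedtype.

Set Implicit Arguments.
Unset Strict Implicit.
Unset Printing Implicit Defensive.

Import Order.TTheory GRing.Theory Num.Theory.
Import numFieldNormedType.Exports.

Local Open Scope classical_set_scope.
Local Open Scope ring_scope.

Variant field_kind := Real | Complex.

Definition RorC (R : realType) (k : field_kind) : numFieldType :=
  match k with Real => R | Complex => R[i]%C end.

Definition conjF (R : realType) (k : field_kind) :
    {rmorphism RorC R k -> RorC R k} :=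
  match k with Real => idfun | Complex => @Num.conj R[i]%C end.

(* Norms over R[i] take (nonnegative real) values in R[i]; reF brings them back
   to R. *)
Definition reF (R : realType) (k : field_kind) : RorC R k -> R :=
  match k with Real => idfun | Complex => @complex.Re R end.

Definition absF (R : realType) (k : field_kind) (c : RorC R k) : R :=
  reF `|c|.

Section InnerProductSpace.
Context (R : realType) (k : field_kind).
Local Notation F := (RorC R k).
Context (H : normedModType F).

Definition normH (x : H) : R := reF `|x|.

Definition norm_from_dot (dot : {dot H for conjF R k}) : Prop :=
  forall x, `|x| ^+ 2 = dot x x.

(* In dimension one the second argument of lambda in represents is always 0,
   so lambda is determined only on pairs (p, 0): uniqueness fails exactly there
   (for nonempty G). *)
Definition one_dimensional : Prop :=
  exists2 e : H, e != 0 & forall x, exists c : F, x = c *: e.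

Context (dot : {dot H for conjF R k}).

Definition linear_isometry (T : {linear H -> H}) : Prop :=
  isometry dot dot T.

Definition isometry_invariant_set (G : set H) : Prop :=
  forall T : {linear H -> H}, linear_isometry T -> T @` G `<=` G.

Context (G : set H).

Definition radii : set R := [set normH g | g in G].

Definition radius (g : G) : radii :=
  SigSub (mem_set (imageP normH (set_valP g))).

Definition finsler_metric (rho : G -> H -> R) : Prop :=
  forall (g : G) (c : F) (h : H), rho g (c *: h) = absF c * rho g h.

(* The point Tg of G is given as g' : G with underlying vector T g. *)
Definition isometry_invariant_metric (rho : G -> H -> R) : Prop :=
  forall T : {linear H -> H}, linear_isometry T ->
  forall g g' : G, val g' = T (val g) ->
  forall h : H, rho g' (T h) = rho g h.

Definition even_homogeneous (lambda : radii -> R * R -> R) : Prop :=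
  (forall r p q t, 0 <= t -> lambda r (t * p, t * q) = t * lambda r (p, q)) /\
  (forall r p q, lambda r (- p, q) = lambda r (p, q) /\
                 lambda r (p, - q) = lambda r (p, q)).

Definition represents (rho : G -> H -> R) (lambda : radii -> R * R -> R)
    : Prop :=
  forall (g : G) (h : H),
    rho g h = lambda (radius g)
      (absF (dot h (val g)),
       Num.sqrt (normH h ^+ 2 * normH (val g) ^+ 2 - absF (dot h (val g)) ^+ 2)).

End InnerProductSpace.

(* Main.v *)
From HB Require Import structures.
Require Import Defs.
From mathcomp Require Import all_boot all_order all_algebra.
From mathcomp Require Import complex sesquilinear.
From mathcomp Require Import boolp classical_sets functions reals topology.
From mathcomp Require Import normedtype.
From mathcomp Require Import ring.

Set Implicit Arguments.
Unset Strict Implicit.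

Import Order.TTheory GRing.Theory Num.Theory.
Import numFieldNormedType.Exports.

Local Open Scope classical_set_scope.
Local Open Scope ring_scope.

(** The theorem is a description of orbits.  An isometry T carries (g, h) to
    (T g, T h), and the triple (|g|, |h|, <h, g>) is invariant.  Conversely this
    triple separates orbits: of two pairs with the same triple, one is taken to
    the other by a composite of two reflectors (isometry_pair).  For |x| = |y| the reflector
      z |-> z - (<z, x - y> / <x, x - y>) (x - y)
    is an isometry taking x to y; being a rank-one perturbation of the identity,
    it is defined on the whole space whatever the dimension of H.

    Homogeneity of the metric under unit scalars lets one replace <h, g> by its
    modulus, so an invariant metric rho_g(h) depends only on |g| and on
    p = |<h, g>|, q = sqrt(|h|^2 |g|^2 - |<h, g>|^2) (invariant_coord).  By
    Pythagoras q is |g| times the length of the part of h orthogonal to g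
    (coordE); this gives q its homogeneity in h, and lets |h| be recovered from
    |g|, p and q.

    The function lambda is then read off: lambda_r(p, q) is the value of rho at
    any pair of radius r with coordinates (|p|, |q|), and 0 if there is no such
    pair.  The second case is what makes one formula work in every dimension: on
    a line q is always 0.  If H is not a line, then every g in G has a nonzero
    vector orthogonal to it, all coordinates p, q >= 0 occur (coord_surj), and
    lambda is forced by its values there together with evenness. *)

(** * Scalars *)

(** The inclusion of the reals into the scalar field.  It is injective and
    order-reflecting, so real identities between norms are proved among scalars,
    where the inner product lives. *)
Definition ofR (R : realType) (k : field_kind) : {rmorphism R -> RorC R k} :=
  match k return {rmorphism R -> RorC R k} with
  | Defs.Real => idfun | Defs.Complex => real_complex R end.

Section Scalars.
Context (R : realType) (k : field_kind).
Local Notation F := (RorC R k).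
Local Notation "r %:K" := (ofR R k r) (at level 2, format "r %:K").

Lemma ofRK r : reF (r%:K) = r.
Proof. by case: k. Qed.

Lemma reFK (x : F) : 0 <= x -> (reF x)%:K = x.
Proof. by case: k x => //= x x0; rewrite RRe_real// ger0_real. Qed.

Lemma ofR_inj : injective (ofR R k).
Proof. exact: can_inj ofRK. Qed.

Lemma ler_ofR a b : (a%:K <= b%:K) = (a <= b).
Proof. by case: k => //=; rewrite lecR. Qed.

Lemma ofR_ge0 r : (0 <= r%:K) = (0 <= r).
Proof. by rewrite -ler_ofR rmorph0. Qed.

Lemma normF_ofR r : `|r%:K| = `|r|%:K.
Proof.
case: (ger0P r) => r0; first by rewrite ger0_norm ?ofR_ge0.
by rewrite -normrN -rmorphN ger0_norm// ofR_ge0 oppr_ge0 ltW.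
Qed.

Lemma ofR_absF (c : F) : (absF c)%:K = `|c|.
Proof. exact: reFK. Qed.

Lemma absF_ofR r : absF (r%:K) = `|r|.
Proof. by rewrite /absF normF_ofR ofRK. Qed.

Lemma absF_ge0 (c : F) : 0 <= absF c.
Proof. by rewrite -ofR_ge0 ofR_absF. Qed.

Lemma absFM (c d : F) : absF (c * d) = absF c * absF d.
Proof. by apply: ofR_inj; rewrite rmorphM !ofR_absF normrM. Qed.

Lemma mul_conjF (c : F) : c * conjF R k c = `|c| ^+ 2.
Proof. by case: k c => [c|c] /=; [rewrite real_normK ?num_real | rewrite normCK]. Qed.

(** Scalars of equal modulus differ by a unit scalar, which homogeneity of a
    Finsler metric absorbs. *)
Lemma eq_absF (a b : F) : absF a = absF b -> exists2 c, absF c = 1 & a = c * b.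
Proof.
move=> ab; have {}ab : `|a| = `|b| by rewrite -!ofR_absF ab.
have [b0|b0] := eqVneq b 0.
  exists 1; first by rewrite -(rmorph1 (ofR R k)) absF_ofR normr1.
  by apply/eqP; rewrite b0 mulr0 -normr_eq0 ab b0 normr0.
exists (a / b); last by rewrite mulfVK.
by apply: ofR_inj; rewrite ofR_absF normf_div ab divff ?rmorph1 ?normr_eq0.
Qed.

End Scalars.

(** * Coordinates of a vector relative to another one *)

Section InnerProduct.
Context (R : realType) (k : field_kind).
Local Notation F := (RorC R k).
Local Notation "r %:K" := (ofR R k r) (at level 2, format "r %:K").
Context (H : normedModType F) (dot : {dot H for conjF R k}).
Hypothesis Hdot : norm_from_dot dot.

Lemma ofR_normH (x : H) : (normH x)%:K = `|x|.
Proof. exact: reFK. Qed.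

Lemma normH_ge0 (x : H) : 0 <= normH x.
Proof. by rewrite -(@ofR_ge0 R k) ofR_normH. Qed.

Lemma normH_eq0 (x : H) : (normH x == 0) = (x == 0).
Proof. by rewrite -(inj_eq (@ofR_inj R k)) ofR_normH rmorph0 normr_eq0. Qed.

Lemma normHZ (c : F) (x : H) : normH (c *: x) = absF c * normH x.
Proof. by apply: (@ofR_inj R k); rewrite rmorphM ofR_absF !ofR_normH normrZ. Qed.

Lemma dot_normH x : dot x x = (normH x ^+ 2)%:K.
Proof. by rewrite rmorphXn ofR_normH. Qed.

Lemma dot_eq0 x : (dot x x == 0) = (x == 0).
Proof. by rewrite -Hdot sqrf_eq0 normr_eq0. Qed.

Lemma dotC x y : dot x y = conjF R k (dot y x).
Proof. by rewrite hermC mul1r. Qed.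

Lemma dotZl c x y : dot (c *: x) y = c * dot x y.
Proof. exact: linearZl_LR. Qed.

Lemma dotZr c x y : dot x (c *: y) = conjF R k c * dot x y.
Proof. by rewrite dotC dotZl rmorphM -dotC. Qed.

Lemma dotDl x y z : dot (x + y) z = dot x z + dot y z.
Proof. exact: linearDl. Qed.

Lemma dotBl x y z : dot (x - y) z = dot x z - dot y z.
Proof. exact: linearBl. Qed.

Lemma dotBr x y z : dot x (y - z) = dot x y - dot x z.
Proof. exact: linearBr. Qed.

(** The component of h orthogonal to g. *)
Definition rejection (h g : H) : H := h - (dot h g / dot g g) *: g.

Lemma dot_rejection h g : g != 0 -> dot (rejection h g) g = 0.
Proof. by move=> g0; rewrite dotBl dotZl mulfVK ?dot_eq0// subrr. Qed.

Lemma rejectionZ c h g : rejection (c *: h) g = c *: rejection h g.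
Proof. by rewrite /rejection scalerBr scalerA dotZl mulrA. Qed.

(** Pythagoras for h = (multiple of g) + rejection h g, multiplied by |g|^2 to
    avoid division. *)
Lemma pythagoras h g : g != 0 ->
  normH h ^+ 2 * normH g ^+ 2 =
  (normH (rejection h g) * normH g) ^+ 2 + absF (dot h g) ^+ 2.
Proof.
move=> g0; apply: (@ofR_inj R k).
have dot_sub : dot (rejection h g) (rejection h g) =
    dot h h - dot h g / dot g g * dot g h.
  by rewrite [LHS]dotBr dotZr dot_rejection// mulr0 subr0 dotBl dotZl.
rewrite rmorphD [in RHS]exprMn !(rmorphM (ofR R k) (_ ^+ 2)) -!dot_normH.
rewrite rmorphXn /= ofR_absF -mul_conjF -dotC dot_sub mulrBl.
by rewrite [_ / _ * dot g h]mulrAC mulfVK ?dot_eq0// subrK.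
Qed.

Definition coord (g h : H) : R * R :=
  (absF (dot h g),
   Num.sqrt (normH h ^+ 2 * normH g ^+ 2 - absF (dot h g) ^+ 2)).

(** Replaces the square root by a product of lengths; this contains the
    Cauchy-Schwarz inequality, without which the square root would be truncated
    at 0 and would not determine its argument. *)
Lemma coordE g h : g != 0 ->
  coord g h = (absF (dot h g), normH (rejection h g) * normH g).
Proof.
move=> g0; rewrite /coord pythagoras// addrK sqrtr_sqr ger0_norm//.
by rewrite mulr_ge0 ?normH_ge0.
Qed.

Lemma coordZ c g h : g != 0 ->
  coord g (c *: h) = (absF c * (coord g h).1, absF c * (coord g h).2).
Proof.
by move=> g0; rewrite !coordE// dotZl absFM rejectionZ normHZ mulrA.
Qed.

Lemma coord_normH g g' h h' : g != 0 -> normH g = normH g' ->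
  coord g h = coord g' h' -> normH h = normH h'.
Proof.
move=> g0 gg'; have g'0 : g' != 0 by rewrite -normH_eq0 -gg' normH_eq0.
rewrite !coordE// => -[pp' qq'].
have /eqP : normH h ^+ 2 * normH g ^+ 2 = normH h' ^+ 2 * normH g' ^+ 2.
  by rewrite !pythagoras// pp' qq'.
rewrite -gg' -!exprMn eqrXn2 ?mulr_ge0 ?normH_ge0// => /eqP.
by apply: mulIf; rewrite normH_eq0.
Qed.

(** The vector is a multiple of g, which fixes p, plus a multiple of some nonzero
    e orthogonal to g, which fixes q.  Such an e exists because H is not the line
    through g. *)
Lemma coord_surj g p q : ~ one_dimensional H -> g != 0 ->
  0 <= p -> 0 <= q -> exists h, coord g h = (p, q).
Proof.
move=> H1 g0 p0 q0.
have [x xg] : exists x, forall c : F, x <> c *: g.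
  apply: contrapT => /forallNP xg; apply: H1; exists g => // x.
  by have /existsNP[c /contrapT] := xg x; exists c.
pose e := rejection x g.
have e0 : normH e * normH g != 0.
  rewrite mulf_neq0 ?normH_eq0//; apply/eqP => /eqP; rewrite subr_eq0.
  by move=> /eqP /xg.
pose a : F := p%:K / dot g g; pose b : R := q / (normH e * normH g).
have hg : dot (b%:K *: e + a *: g) g = p%:K.
  by rewrite dotDl !dotZl dot_rejection// mulr0 add0r mulfVK ?dot_eq0.
exists (b%:K *: e + a *: g); rewrite coordE// hg absF_ofR ger0_norm//.
rewrite /rejection hg addrK normHZ absF_ofR.
by rewrite ger0_norm ?divr_ge0 ?mulr_ge0 ?normH_ge0// -mulrA divfK.
Qed.

(** * Transitivity of isometries *)

(** For |x| = |y| this is the generalized reflection moving x to y and fixing the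
    orthogonal complement of x - y.  Over the reals it is the usual orthogonal
    reflection exchanging x and y; over the complex numbers it multiplies x - y
    by - conj s / s, where s = <x, x - y>. *)
Definition reflector (x y z : H) : H :=
  z - (dot z (x - y) / dot x (x - y)) *: (x - y).

Lemma reflector_is_linear x y : linear (reflector x y).
Proof.
move=> a u v; rewrite /reflector; move: (x - y) => w.
rewrite dotDl dotZl mulrDl scalerDl -mulrA -scalerA.
by rewrite [in RHS]scalerBr opprD addrACA.
Qed.

HB.instance Definition _ x y :=
  GRing.isLinear.Build F H H *:%R (reflector x y) (reflector_is_linear x y).

Lemma reflector_orth x y z : dot z (x - y) = 0 -> reflector x y z = z.
Proof. by rewrite /reflector => ->; rewrite mul0r scale0r subr0. Qed.

Section EqualNorms.
Context (x y : H) (xy : normH x = normH y).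

(** With s = <x, x - y> this reads |x - y|^2 = s + conj s.  So s vanishes only if
    x = y, and 1 - |x - y|^2 / s = - conj s / s has modulus 1. *)
Lemma dot_sub_eqnorm :
  dot (x - y) (x - y) = dot x (x - y) + dot (x - y) x.
Proof.
by rewrite dotBl !dotBr dotBl [dot y y]dot_normH -xy -dot_normH; ring.
Qed.

Lemma dot_sub_eq0 : dot x (x - y) = 0 -> x = y.
Proof.
move=> s0; apply/eqP; rewrite -subr_eq0 -dot_eq0 dot_sub_eqnorm.
by rewrite [dot (x - y) x]dotC s0 rmorph0 addr0.
Qed.

Lemma reflectorE : reflector x y x = y.
Proof.
rewrite /reflector; have [s0|s0] := eqVneq (dot x (x - y)) 0.
  by rewrite -(dot_sub_eq0 s0) subrr scaler0 subr0.
by rewrite divff// scale1r opprB addrC subrK.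
Qed.

Lemma reflector_isometry : linear_isometry dot (reflector x y).
Proof.
move=> z w /=; have [s0|s0] := eqVneq (dot x (x - y)) 0.
  by rewrite !reflector_orth // -(dot_sub_eq0 s0) subrr linear0r.
have t0 : dot (x - y) x != 0 by rewrite dotC fmorph_eq0.
have := dot_sub_eqnorm; rewrite /reflector.
move: (x - y) s0 t0 => d s0 t0 dd.
have -> u v (c e : F) : dot (u - c *: d) (v - e *: d) =
    dot u v - conjF R k e * dot u d - c * dot d v + c * conjF R k e * dot d d.
  by rewrite dotBl !dotBr !dotZl !dotZr; ring.
have -> : conjF R k (dot w d / dot x d) = dot d w / dot d x.
  by rewrite rmorphM /= fmorphV [dot d w]dotC [dot d x]dotC.
have cancel (K : fieldType) (a b c s t : K) : s != 0 -> t != 0 ->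
    a - c / t * b - b / s * c + b / s * (c / t) * (s + t) = a.
  by move=> s_neq0 t_neq0; field; rewrite s_neq0 t_neq0.
by rewrite dd cancel.
Qed.

End EqualNorms.

Lemma linear_isometry_normH (T : {linear H -> H}) x :
  linear_isometry dot T -> normH (T x) = normH x.
Proof.
move=> Tiso; apply: (@ofR_inj R k); rewrite !ofR_normH.
by apply/eqP; rewrite -(@eqrXn2 _ 2)// !Hdot Tiso.
Qed.

(** A first reflector moves g to g'; a second one moves the image of h to h'.  The
    second one fixes g', because <T1 h - h', g'> = <h, g> - <h', g'> = 0. *)
Lemma isometry_pair g g' h h' : normH g = normH g' ->
    normH h = normH h' -> dot h g = dot h' g' ->
  exists T : {linear H -> H}, [/\ linear_isometry dot T, T g = g' & T h = h'].
Proof.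
move=> gg' hh' hg.
pose T1 : {linear H -> H} := reflector g g'.
have T1iso : linear_isometry dot T1 by exact: reflector_isometry.
have T1g : T1 g = g' by exact: reflectorE.
have T1h : normH (T1 h) = normH h' by rewrite linear_isometry_normH.
pose T2 : {linear H -> H} := reflector (T1 h) h'.
have T2iso : linear_isometry dot T2 by exact: reflector_isometry.
exists (T2 \o T1); split => /=.
- by move=> x y /=; rewrite T2iso T1iso.
- rewrite T1g; apply: reflector_orth.
  by rewrite dotC dotBl -hg -[in dot (T1 h) g']T1g T1iso subrr rmorph0.
- exact: reflectorE.
Qed.

(** * Invariant metrics *)

Lemma even_homogeneous_norm (G : set H) (lambda : radii G -> R * R -> R) r p q :
  even_homogeneous lambda -> lambda r (p, q) = lambda r (`|p|, `|q|).
Proof.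
move=> [_ ev].
have -> : lambda r (p, q) = lambda r (`|p|, q).
  by have [//|p0] := ger0P p; rewrite (ev r p q).1.
by have [//|q0] := ger0P q; rewrite (ev r `|p| q).2.
Qed.

Section Metric.
Context (G : set H) (G0 : ~ G 0) (rho : G -> H -> R).

Lemma val_neq0 (g : G) : val g != 0.
Proof. by apply/eqP => g0; apply: G0; rewrite -g0; exact: set_valP. Qed.

Lemma eq_radius (g g' : G) :
  (Defs.radius g = Defs.radius g') <-> (normH (val g) = normH (val g')).
Proof. by split => [/(congr1 val)|gg'] //; apply: val_inj. Qed.

Lemma radius_surj (r : radii G) : exists g : G, Defs.radius g = r.
Proof.
have [g Gg gr] := set_valP r.
by exists (SigSub (mem_set Gg)); apply: val_inj.
Qed.

Lemma represents_invariant lambda :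
  represents dot rho lambda -> isometry_invariant_metric dot rho.
Proof.
move=> rep T Tiso g g' Tg h.
have gg' : Defs.radius g' = Defs.radius g.
  by apply/eq_radius; rewrite Tg linear_isometry_normH.
by rewrite !rep gg' Tg !linear_isometry_normH// Tiso.
Qed.

(** Evenness reduces to p, q >= 0, where the values are prescribed because every
    such pair is attained. *)
Lemma representation_unique lambda lambda' : ~ one_dimensional H ->
    even_homogeneous lambda -> represents dot rho lambda ->
    even_homogeneous lambda' -> represents dot rho lambda' ->
  lambda = lambda'.
Proof.
move=> H1 ev rep ev' rep'; apply/funext => r; apply/funext => -[p q].
rewrite (even_homogeneous_norm _ _ _ ev) (even_homogeneous_norm _ _ _ ev').
have [g <-] := radius_surj r.
have [h <-] := coord_surj H1 (val_neq0 g) (normr_ge0 p) (normr_ge0 q).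
by rewrite -[LHS]rep -[RHS]rep'.
Qed.

Context (Hrho : finsler_metric rho) (inv : isometry_invariant_metric dot rho).

(** The data determine |g|, |h| and <h, g> up to a unit scalar c; after multiplying
    h' by c an isometry takes one pair to the other. *)
Lemma invariant_coord (g g' : G) h h' :
    Defs.radius g = Defs.radius g' -> coord (val g) h = coord (val g') h' ->
  rho g h = rho g' h'.
Proof.
move=> /eq_radius gg' cc'; have hh' := coord_normH (val_neq0 g) gg' cc'.
case: cc' => /eq_absF[c c1 hg] _.
have hch' : normH h = normH (c *: h') by rewrite normHZ c1 mul1r.
have [|T [Tiso Tg Th]] := isometry_pair gg' hch'; first by rewrite dotZl.
by rewrite -(inv Tiso (esym Tg)) Th Hrho c1 mul1r.
Qed.

(** At most a singleton if rho is invariant; empty for q <> 0 if H is a line. *)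
Definition attained_values (r : radii G) (pq : R * R) : set R :=
  [set v | exists g h, [/\ Defs.radius g = r,
     coord (val g) h = (`|pq.1|, `|pq.2|) & v = rho g h]].

Definition lambda_of (r : radii G) (pq : R * R) : R :=
  xget 0 (attained_values r pq).

Lemma lambda_ofE (g : G) h p q : coord (val g) h = (`|p|, `|q|) ->
  lambda_of (Defs.radius g) (p, q) = rho g h.
Proof.
move=> hpq; apply: xget_unique => [|_ [g' [h' [gg' h'pq ->]]]].
  by exists g, h.
by apply: invariant_coord => //; rewrite h'pq.
Qed.

Lemma lambda_of_represents : represents dot rho lambda_of.
Proof.
move=> g h; rewrite (lambda_ofE (h := h))//.
by rewrite ger0_norm ?absF_ge0// ger0_norm ?sqrtr_ge0.
Qed.

Lemma coord_val_scale (g : G) h p q t : coord (val g) h = (`|p|, `|q|) ->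
  coord (val g) (t%:K *: h) = (`|t * p|, `|t * q|).
Proof.
by move=> hpq; rewrite coordZ ?val_neq0// hpq absF_ofR !normrM.
Qed.

(** For t > 0, scaling h by t maps the pairs with coordinates (|p|, |q|) onto those
    with coordinates (|tp|, |tq|), so the default value 0 is taken on both sides
    or on neither.  For t = 0 the coordinates (0, 0) are those of the zero
    vector. *)
Lemma lambda_of_scale r p q t : 0 <= t ->
  lambda_of r (t * p, t * q) = t * lambda_of r (p, q).
Proof.
rewrite le_eqVlt => /predU1P[<-|t0].
  have [g <-] := radius_surj r; rewrite !mul0r (lambda_ofE (h := 0 *: 0)).
    by rewrite Hrho -(rmorph0 (ofR R k)) absF_ofR normr0 mul0r.
  by rewrite coordZ ?val_neq0// -(rmorph0 (ofR R k)) absF_ofR normr0 !mul0r.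
have [[_ [g [h [<- hpq _]]]]|none] := pselect (attained_values r (p, q) !=set0).
  rewrite (lambda_ofE hpq) (lambda_ofE (coord_val_scale t hpq)) Hrho absF_ofR.
  by rewrite gtr0_norm.
rewrite /lambda_of !xgetPN ?mulr0// => v.
  by move=> rv; apply: none; exists v.
move=> [g [h [gr /(coord_val_scale t^-1) hpq _]]]; apply: none.
by exists (rho g (t^-1%:K *: h)), g, (t^-1%:K *: h); rewrite hpq !mulKf ?gt_eqF.
Qed.

Lemma lambda_of_even_homogeneous : even_homogeneous lambda_of.
Proof.
split=> [r p q t|r p q]; first exact: lambda_of_scale.
by rewrite /lambda_of /attained_values /= !normrN.
Qed.

End Metric.
End InnerProduct.

Theorem proposition2p3 (R : realType) (k : field_kind)
    (H : normedModType (RorC R k)) (dot : {dot H for conjF R k})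
    (Hdot : norm_from_dot dot)
    (G : set H) (Gopen : open G) (Ginv : isometry_invariant_set dot G)
    (G0 : ~ G 0) (rho : G -> H -> R) (Hrho : finsler_metric rho) :
  (isometry_invariant_metric dot rho <->
     exists lambda : radii G -> R * R -> R,
       even_homogeneous lambda /\ represents dot rho lambda) /\
  (~ one_dimensional H ->
     (isometry_invariant_metric dot rho <->
        exists! lambda : radii G -> R * R -> R,
          even_homogeneous lambda /\ represents dot rho lambda)).
Proof.
have ex : isometry_invariant_metric dot rho ->
    even_homogeneous (lambda_of dot rho) /\ represents dot rho (lambda_of dot rho).
  by split; [exact: lambda_of_even_homogeneous | exact: lambda_of_represents].
split=> [|H1]; split.
- by move=> /ex; exists (lambda_of dot rho).
- by move=> [lambda [_]]; exact: represents_invariant.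
- move=> /ex[ev rep]; exists (lambda_of dot rho); split=> // lambda [ev' rep'].
  exact: representation_unique ev rep ev' rep'.
- by move=> [lambda [[_]] rep _]; exact: represents_invariant rep.
Qed.
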